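(* For any integer $t\geq 0$, there exist a graph $G=(V,E)$ and an edge $e\in E$ such that $\operatorname{ppt}(G_e)\leq \operatorname{ppt}(G)-t$, where $G_e$ is the graph obtained from $G$ by subdividing the edge $e$.
   Context: All graphs are finite and simple. For an edge $e=uv$ of $G$, the graph $G_e$ obtained by subdividing $e$ has vertex set $V(G)\cup\{w\}$ with $w$ a new vertex, and edge set $(E(G)\setminus\{uv\})\cup\{uw,wv\}$. For a graph $G$ and $S\subseteq V(G)$, let $N(v)$ be the set of neighbors of $v$ and $N[S]=S\cup\bigcup_{s\in S}N(s)$. Define $S^{[0]}=S$, $S^{[1]}=N[S]$, and for $i\geq 1$, $S^{[i+1]}=S^{[i]}\cup\{w\in V(G) : \exists\, v\in S^{[i]},\ N(v)\setminus S^{[i]}=\{w\}\}$. The set $S$ is a power dominating set of $G$ if $S^{[\ell]}=V(G)$ for some $\ell$; a minimum power dominating set is one of minimum cardinality. For a power dominating set $S$, $\operatorname{ppt}(G,S)$ is the smallest $\ell\ge 0$ with $S^{[\ell]}=V(G)$. The power propagation time of $G$ is $\operatorname{ppt}(G)=\min\{\operatorname{ppt}(G,S) : S \text{ is a minimum power dominating set of } G\}$. *)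

(* Defs.v *)
From mathcomp Require Import all_boot.
From mathcomp Require Import boolp.

Set Implicit Arguments.
Unset Strict Implicit.
Unset Printing Implicit Defensive.

Record sgraph := SGraph {
  vertex :> finType;
  adj : rel vertex;
  adj_sym : symmetric adj;
  adj_irr : irreflexive adj
}.

Section Subdivision.
Variables (G : sgraph) (u v : G).

(* [None] is the new vertex. *)
Definition subdivide_adj (a b : option G) : bool :=
  match a, b with
  | Some x, Some y =>
      adj x y && ~~ ((x == u) && (y == v) || (x == v) && (y == u))
  | Some x, None | None, Some x => (x == u) || (x == v)
  | None, None => false
  end.

Lemma subdivide_sym : symmetric subdivide_adj.
Proof.
case=> [x|] [y|] //=; rewrite adj_sym orbC.
by rewrite (andbC (x == v)) (andbC (x == u)).
Qed.

Lemma subdivide_irr : irreflexive subdivide_adj.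
Proof. by case=> [x|] //=; rewrite adj_irr. Qed.

(* Meant for [adj u v], i.e. for an edge [uv] of [G]. *)
Definition subdivide : sgraph := SGraph subdivide_sym subdivide_irr.

End Subdivision.

Section PowerDomination.
Variable G : sgraph.
Implicit Types S : {set G}.

Definition nbhd (v : G) : {set G} := [set w | adj v w].

Definition closed_nbhd S : {set G} := S :|: \bigcup_(s in S) nbhd s.

Definition force_step S : {set G} :=
  S :|: [set w | [exists v in S, nbhd v :\: S == [set w]]].

(* The first step is domination, every later one is zero forcing. *)
Fixpoint observed S (i : nat) : {set G} :=
  match i with
  | 0 => S
  | 1 => closed_nbhd S
  | j.+1 => force_step (observed S j)
  end.

Definition power_dominating S : Prop :=
  exists l, observed S l == [set: G].

Definition min_power_dominating S : Prop :=
  power_dominating S /\ forall S', power_dominating S' -> #|S| <= #|S'|.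

Definition ppt_of S (pdS : power_dominating S) : nat := ex_minn pdS.

Definition attains_ppt (n : nat) : bool :=
  `[< exists S (pdS : power_dominating S),
        min_power_dominating S /\ ppt_of pdS = n >].

Lemma attains_ppt_ex : exists n, attains_ppt n.
Proof.
have pdT : power_dominating [set: G] by exists 0; rewrite /=.
pose P k := `[< exists2 S : {set G}, power_dominating S & #|S| = k >].
have exP : exists k, P k by exists #|[set: G]|; apply/asboolP; exists [set: G].
case: (ex_minnP exP) => k /asboolP[S pdS <-] minS.
exists (ppt_of pdS); apply/asboolP; exists S, pdS; split=> //; split=> // S' pdS'.
by apply: minS; apply/asboolP; exists S'.
Qed.

Definition ppt : nat := ex_minn attains_ppt_ex.

End PowerDomination.

(* Main.v *)
Require Import Defs.
From HB Require Import structures.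
From mathcomp Require Import all_boot.
From mathcomp Require Import boolp zify.

(** Subdividing an edge can shorten power propagation by raising the power
    domination number: one more vertex is then available, and it may speed up
    everything.

    The graph [ladder n] has a vertex [Hub] with three pendant leaves, which
    force [Hub] into every power dominating set of size one.  [Hub] also sees
    [Left], [Right] and [Apex]; [Left] and [Right] are adjacent to each other
    and to the first vertex of a path with [n] vertices; [Apex] is adjacent to
    the whole path.

    In [ladder n] the set consisting of [Hub] is power dominating, but it is
    slow: after the domination step the path is observed one vertex at a time,
    because [Apex] has too many unobserved neighbours to be of any help
    ([observed_hub]).  As this is the only minimum power dominating set, the
    power propagation time is at least [n.+1].

    Now subdivide the edge between [Left] and [Right].  The new vertex and the
    path together form a fort: [Left] and [Right] each see the new vertex and
    the first path vertex, and [Apex] sees the whole path, so none of them ever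
    forces.  As [Hub] is not adjacent to this fort, no single vertex is power
    dominating any more ([subdivided_not_dominated_by_one]).  Hence [Hub] and
    [Apex] form a minimum power dominating set, and it finishes in two steps:
    everything but the new vertex is dominated, and [Left] then forces the new
    vertex. *)

Set Implicit Arguments.
Unset Strict Implicit.
Unset Printing Implicit Defensive.

(** * Forcing, forts and leaves *)

Section PowerDominationTheory.
Variable G : sgraph.
Implicit Types (S F A : {set G}) (v w x h : G).

Lemma in_closed_nbhd S w :
  reflect (w \in S \/ exists2 s, s \in S & adj s w) (w \in closed_nbhd S).
Proof.
rewrite inE; apply: (iffP orP) => -[wS|]; try by left.
  by case/bigcupP=> s sS; rewrite inE => sw; right; exists s.
by case=> s sS sw; right; apply/bigcupP; exists s; rewrite ?inE.
Qed.

Lemma in_force_step A w :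
  reflect (w \in A \/ exists v, [/\ v \in A, adj v w, w \notin A
             & forall x, adj v x -> x \notin A -> x = w])
          (w \in force_step A).
Proof.
rewrite !inE; apply: (iffP orP) => -[wA|]; try by left.
  case/existsP=> v /andP[vA /eqP/setP Nv]; right; exists v.
  have := Nv w; rewrite !inE eqxx => /andP[wA vw]; split=> // x vx xA.
  by have := Nv x; rewrite !inE vx xA => /esym/eqP.
case=> v [vA vw wA Nv]; right; apply/existsP; exists v; rewrite vA /=.
apply/eqP/setP=> x; rewrite !inE; apply/andP/eqP => [[xA vx]|->]; last by [].
exact: Nv.
Qed.

Lemma observedSS S i : observed S i.+2 = force_step (observed S i.+1).
Proof. by []. Qed.

(** A set [F] in which no outside vertex has exactly one neighbour is a fort:
    an outside vertex never has a unique unobserved neighbour in [F], so [F]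
    can only be entered by the initial set or during the domination step. *)
Lemma power_dominating_meets_fort S F x :
    x \in F ->
    (forall v w, v \notin F -> w \in F -> adj v w ->
       exists w', [/\ w' \in F, adj v w' & w' != w]) ->
    power_dominating S ->
  exists2 s, s \in S & s \in closed_nbhd F.
Proof.
move=> xF fortF [l /eqP obsT].
have [/existsP[s /andP[]]|noS] := boolP [exists s in S, s \in closed_nbhd F].
  by exists s.
have avoid s : s \in S -> s \notin closed_nbhd F.
  by move=> sS; apply: contra noS => sF; apply/existsP; exists s; rewrite sS.
suff /(_ l x) : forall i w, w \in observed S i -> w \notin F.
  by rewrite obsT inE xF => /(_ isT).
have avoidF w : w \in S -> w \notin F.
  by move=> /avoid; apply: contra => wF; apply/in_closed_nbhd; left.
elim=> [|[|i] IHi] w; first exact: avoidF.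
  case/in_closed_nbhd=> [/avoidF//|[s sS sw]].
  apply: contra (avoid s sS) => wF; apply/in_closed_nbhd.
  by right; exists w; rewrite // adj_sym.
rewrite observedSS; case/in_force_step=> [/IHi//|[v [/IHi vF vw _ Nv]]].
apply/negP=> /(fortF v w vF)/(_ vw)[w' [w'F vw' /eqP[]]].
by apply: Nv vw' _; apply: contraL w'F => /IHi.
Qed.

(** Any two leaves at [h] form a fort, so a single power dominating vertex
    has to lie in every set made of [h] and two of the leaves; with three
    leaves only [h] does. *)
Lemma three_leaves S h (leaf : 'I_3 -> G) :
    injective leaf -> (forall i x, adj (leaf i) x = (x == h)) ->
    power_dominating S -> #|S| <= 1 ->
  S = [set h].
Proof.
move=> leaf_inj leafE pdS leS1.
have meets i j : i != j ->
    exists2 s, s \in S & [|| s == h, s == leaf i | s == leaf j].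
  move=> neq_ij; have := @power_dominating_meets_fort S [set leaf i; leaf j]
    (leaf i) (set21 _ _) _ pdS; case=> [v w vF|s sS sF].
    rewrite !inE => /orP[]/eqP-> ; rewrite adj_sym leafE => /eqP->.
      exists (leaf j); rewrite set22 adj_sym leafE eqxx.
      by rewrite (inj_eq leaf_inj) eq_sym.
    exists (leaf i); rewrite set21 adj_sym leafE eqxx.
    by rewrite (inj_eq leaf_inj).
  exists s => //; case/in_closed_nbhd: sF => [|[l]].
    by rewrite !inE => ->; rewrite orbT.
  by rewrite !inE => /orP[]/eqP->; rewrite leafE => ->.
have eqS := card_le1_eqP leS1.
have hS : h \in S.
  have [//|hNS] := boolP (h \in S).
  pose i0 : 'I_3 := inord 0; pose i1 : 'I_3 := inord 1.
  pose i2 : 'I_3 := inord 2.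
  have neq01 : i0 != i1 by rewrite -val_eqE /= !inordK.
  have neq02 : i0 != i2 by rewrite -val_eqE /= !inordK.
  have neq12 : i1 != i2 by rewrite -val_eqE /= !inordK.
  case: (meets _ _ neq01) (meets _ _ neq02) (meets _ _ neq12).
  move=> s sS ss [s' s'S ss'] [s'' s''S ss''].
  rewrite (eqS _ _ sS s'S) in ss'; rewrite (eqS _ _ sS s''S) in ss''.
  have sh : s == h = false by apply: contraNF hNS => /eqP<-.
  move: ss ss' ss''; rewrite sh /= => /orP[]/eqP->; rewrite !(inj_eq leaf_inj).
    by rewrite (negbTE neq01) (negbTE neq02).
  by rewrite eq_sym (negbTE neq01) (negbTE neq12).
by apply/setP=> x; rewrite inE; apply/idP/eqP => [xS|->//]; apply: eqS.
Qed.

Lemma ppt_le S l :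
  min_power_dominating S -> observed S l = [set: G] -> ppt G <= l.
Proof.
move=> minS obsT; have pdS := minS.1; rewrite /ppt.
case: ex_minnP => m _ /(_ (ppt_of pdS)) le_m.
apply: leq_trans (le_m _) _; first by apply/asboolP; exists S, pdS.
by rewrite /ppt_of; case: ex_minnP => k _; apply; apply/eqP.
Qed.

Lemma ppt_ge k :
    (forall S l, min_power_dominating S -> observed S l = [set: G] -> k <= l) ->
  k <= ppt G.
Proof.
move=> ge_k; rewrite /ppt; case: ex_minnP => m /asboolP[S [pdS [minS <-]]] _.
by rewrite /ppt_of; case: ex_minnP => l /eqP obsT _; apply: ge_k minS obsT.
Qed.

End PowerDominationTheory.

(** * The graph *)

Section Ladder.
Variable n : nat.

Inductive ladder_vertex :=
  Hub | Left | Right | Apex | Leaf of 'I_3 | Rung of 'I_n.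

Definition ladder_code (x : ladder_vertex) : bool * bool + ('I_3 + 'I_n) :=
  match x with
  | Hub => inl (false, false)
  | Left => inl (false, true)
  | Right => inl (true, false)
  | Apex => inl (true, true)
  | Leaf i => inr (inl i)
  | Rung i => inr (inr i)
  end.

Definition ladder_decode (c : bool * bool + ('I_3 + 'I_n)) : ladder_vertex :=
  match c with
  | inl (false, false) => Hub
  | inl (false, true) => Left
  | inl (true, false) => Right
  | inl (true, true) => Apex
  | inr (inl i) => Leaf i
  | inr (inr i) => Rung i
  end.

Lemma ladder_codeK : cancel ladder_code ladder_decode.
Proof. by case. Qed.

HB.instance Definition _ := Finite.copy ladder_vertex (can_type ladder_codeK).

Definition ladder_arc (x y : ladder_vertex) : bool :=
  match x, y with
  | Hub, (Leaf _ | Left | Right | Apex) => true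
  | Left, Right => true
  | (Left | Right), Rung i => val i == 0
  | Apex, Rung _ => true
  | Rung i, Rung j => val j == i.+1
  | _, _ => false
  end.

Definition ladder_adj x y := ladder_arc x y || ladder_arc y x.

Lemma ladder_adj_sym : symmetric ladder_adj.
Proof. by move=> x y; rewrite /ladder_adj orbC. Qed.

Lemma ladder_adj_irr : irreflexive ladder_adj.
Proof. by case=> //= i; rewrite /ladder_adj /= orbb ltn_eqF. Qed.

Definition ladder : sgraph := SGraph ladder_adj_sym ladder_adj_irr.

(** The first step at which [Hub] alone observes a given vertex. *)
Definition hub_time (x : ladder) : nat :=
  match x with
  | Hub => 0
  | Rung i => i.+2
  | _ => 1
  end.

(** Once [Hub], its neighbours and [k] rungs are observed, rung number [k]
    follows, forced by [Left] or by the previous rung.  Later rungs have to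
    wait: they are not adjacent to an observed vertex other than [Apex], which
    still has several unobserved neighbours. *)
Lemma force_step_hub_time k :
  force_step [set x | hub_time x <= k.+1] = [set x | hub_time x <= k.+2].
Proof.
apply/setP=> w; rewrite [in RHS]inE; apply/in_force_step/idP.
  rewrite !inE; case=> [/leqW//|[v [vk vw _ Nv]]].
  rewrite leqNgt; apply/negP=> late_w.
  case: w vw Nv late_w => //= j vw Nv; rewrite !ltnS => lt_kj.
  (* The predecessor of a rung that is at least two steps late is unobserved,
     so [Apex] cannot force that rung. *)
  have lt_pn : j.-1 < n by have := ltn_ord j; lia.
  have := Nv (Rung (Ordinal lt_pn)); rewrite inE /=.
  case: v vk vw {Nv} => [||||i|i] //=; rewrite inE /adj /= /ladder_adj /= ?orbF;
    try lia.
  move=> _ _ /(_ isT) eqp.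
  have [/(congr1 val) /=] : Rung (Ordinal lt_pn) = Rung j by apply: eqp; lia.
  by lia.
rewrite leq_eqVlt => /orP[/eqP tw|]; last by left; rewrite inE.
right; case: w tw => //= j [jk].
have late_j : (Rung j : ladder) \notin [set x | hub_time x <= k.+1].
  by rewrite inE /= jk ltnn.
have [k0|k_gt0] := posnP k.
  exists Left; split=> //; first by rewrite inE.
    by rewrite /adj /= /ladder_adj /= orbF jk k0.
  case=> //= i; rewrite /adj /= /ladder_adj /= ?orbF !inE //= => /eqP i0 _.
  by congr Rung; apply: val_inj => /=; lia.
have lt_kn : k.-1 < n by have := ltn_ord j; lia.
exists (Rung (Ordinal lt_kn)); split=> //; first by rewrite inE /=; lia.
  by rewrite /adj /= /ladder_adj /=; lia.
case=> //= i; rewrite /adj /= /ladder_adj /= !inE //= => ki ik.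
by congr Rung; apply: val_inj => /=; lia.
Qed.

Lemma observed_hub k :
  observed [set (Hub : ladder)] k.+1 = [set x | hub_time x <= k.+1].
Proof.
elim: k => [|k IHk]; last by rewrite observedSS IHk force_step_hub_time.
apply/setP=> w; rewrite [in RHS]inE.
apply/in_closed_nbhd/idP=> [[|[s]]|]; rewrite ?inE.
- by move/eqP->.
- by move/eqP->; case: w.
case: w => //= [||||i] _; first (by left); right; exists Hub => //;
  exact: set11.
Qed.

Lemma hub_time_le x : hub_time x <= n.+1.
Proof. by case: x => //= i; rewrite ltnS. Qed.

Lemma hub_power_dominating : power_dominating [set (Hub : ladder)].
Proof.
exists n.+1; rewrite observed_hub; apply/eqP/setP=> x.
by rewrite !inE hub_time_le.
Qed.

Lemma Leaf_inj : injective (Leaf : 'I_3 -> ladder).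
Proof. by move=> i j []. Qed.

Lemma Leaf_adj i (x : ladder) : adj (Leaf i : ladder) x = (x == Hub).
Proof. by case: x. Qed.

Lemma ppt_ladder_ge : 0 < n -> n.+1 <= ppt ladder.
Proof.
move=> n_gt0; apply: ppt_ge => S l [pdS minS] obsT.
have SE : S = [set (Hub : ladder)].
  apply: three_leaves Leaf_inj Leaf_adj pdS _.
  by rewrite -(cards1 (Hub : ladder)) minS //; apply: hub_power_dominating.
have lt_pn : n.-1 < n by lia.
move/setP/(_ (Rung (Ordinal lt_pn))): obsT; rewrite SE in_setT.
case: l => [|l]; first by rewrite inE.
by rewrite observed_hub inE /=; lia.
Qed.

(** * The subdivided graph *)

Definition split_ladder : sgraph := subdivide (Left : ladder) (Right : ladder).

(** The new vertex and the path form a fort that [Hub] does not see, while the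
    leaves require [Hub].  The path needs two vertices, as otherwise [Apex]
    would have a single neighbour in the fort. *)
Lemma subdivided_not_dominated_by_one (S : {set split_ladder}) :
  1 < n -> power_dominating S -> 1 < #|S|.
Proof.
move=> n_gt1 pdS; rewrite ltnNge; apply/negP=> leS1.
have SE : S = [set (Some Hub : split_ladder)].
  apply: (@three_leaves _ S (Some Hub) (fun i => Some (Leaf i)) _ _ pdS leS1).
    by move=> i j [].
  by move=> i [[]|].
pose F : {set split_ladder} :=
  [set x | match x with None | Some (Rung _) => true | _ => false end].
have lt_0n : 0 < n by lia.
pose p0 : split_ladder := Some (Rung (Ordinal lt_0n)).
pose p1 : split_ladder := Some (Rung (Ordinal n_gt1)).
have p0F : p0 \in F by rewrite inE.
have p1F : p1 \in F by rewrite inE.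
have newF : (None : split_ladder) \in F by rewrite inE.
have [v w|s] := power_dominating_meets_fort newF _ pdS; last first.
- rewrite SE inE => /eqP-> /in_closed_nbhd[|[l]]; rewrite inE //.
  by case: l => [[]|].
rewrite !inE; case: v w => [[||||i|i]|] [[||||j|j]|] //= _ _ vw.
- by exists None.
- by exists p0; rewrite p0F.
- by exists None.
- by exists p0; rewrite p0F.
have [->|neq_j] := eqVneq (Some (Rung j) : split_ladder) p0.
  by exists p1; rewrite p1F.
by exists p0; split=> //; rewrite eq_sym.
Qed.

Lemma ppt_split_ladder_le : 1 < n -> ppt split_ladder <= 2.
Proof.
move=> n_gt1; pose S : {set split_ladder} := [set Some Hub; Some Apex].
have obs1 (x : ladder) : (Some x : split_ladder) \in observed S 1.
  apply/in_closed_nbhd; case: x; try by left; rewrite !inE.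
  - by right; exists (Some Hub); rewrite ?inE.
  - by right; exists (Some Hub); rewrite ?inE.
  - by move=> i; right; exists (Some Hub); rewrite ?inE.
  - by move=> i; right; exists (Some Apex); rewrite ?inE.
have obs2 : observed S 2 = [set: split_ladder].
  apply/setP=> x; rewrite in_setT observedSS; apply/in_force_step.
  have [|xN] := boolP (x \in observed S 1); [by left | right].
  exists (Some Left); split=> //.
    by case: x xN => // x; rewrite obs1.
  move=> y _; case: y => [y|]; first by rewrite obs1.
  by case: x xN => // x; rewrite obs1.
apply: (ppt_le _ obs2); split=> [|S' pdS']; first by exists 2; rewrite obs2.
by rewrite cards2; apply: subdivided_not_dominated_by_one.
Qed.

End Ladder.

Theorem proposition17 (t : nat) :
  exists (G : sgraph) (u v : G),
    adj u v /\ ppt (subdivide u v) + t <= ppt G.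
Proof.
(* On [t.+2] rungs the time drops from at least [t.+3] to at most 2; the two
   additional rungs make the new vertex and the path a fort, even if [t = 0]. *)
exists (ladder t.+2), (Left _), (Right _); split=> //.
apply: leq_trans (ppt_ladder_ge (ltn0Sn _)).
apply: leq_trans (leq_add (ppt_split_ladder_le _) (leqnn t)) _ => //; lia.
Qed.
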